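(* Let $1\le j<k\le n$ and suppose that $y_j-y_k=\alpha_j+\dots+\alpha_{k-1}$ lies in $\Sigma_\Theta$. Then for every $\lambda\in\Gamma$ the connective motivic Chern class $\mathrm{St}_\lambda$ lies in $\bigoplus_{\mu\in\Gamma}\mathbb Z[\beta]\llbracket\Lambda\rrbracket_{F_C}\llbracket x_q\rrbracket$, and for every $\mu\in\Gamma$ the difference $\mathrm{St}_\lambda|_\mu-\mathrm{St}_\lambda|_{(j,k)\cdot\mu}$ is divisible by $x_{y_j-y_k}$ in $\mathbb Z[\beta]\llbracket\Lambda\rrbracket_{F_C}\llbracket x_q\rrbracket$, where $(j,k)\in S_n$ is the transposition of $j$ and $k$.
   Context: **Combinatorics.** Fix $n$, $d\ge 1$ and $0=i_0<i_1<\dots<i_d<i_{d+1}=n$; put $p_j=i_j-i_{j-1}$. $\Lambda=\bigoplus_{i=1}^n\mathbb Z y_i$, $\alpha_i=y_i-y_{i+1}$, $\Sigma_\Theta^+=\{y_i-y_j: i<j,\ i\le i_m<j\text{ for some }m\}$, $\Sigma_\Theta=\Sigma_\Theta^+\sqcup(-\Sigma_\Theta^+)$. $W=S_n$ acts on $\Lambda$ by $w(y_i)=y_{w(i)}$; $r_i=(i,i+1)$. $\Gamma$ is the set of words of length $n$ in the letters $0,\dots,d$ in which the letter $d+1-j$ occurs $p_j$ times ($1\le j\le d+1$); $W$ acts on $\Gamma$ by $(w\lambda)_{w(i)}=\lambda_i$. $w_0:=d^{p_1}(d-1)^{p_2}\cdots 0^{p_{d+1}}$, and for $\lambda\in\Gamma$,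 $w_\lambda\in W$ is the minimal length permutation with $\lambda=w_\lambda\cdot w_0$. ($\Gamma$ indexes Schubert cells and torus-fixed points of the flag variety of type $i_1<\dots<i_d$.) **Formal group algebra.** $\mathbb Z[\beta]\llbracket\Lambda\rrbracket_{F_C}$ is the quotient of $\mathbb Z[\beta]\llbracket x_\lambda:\lambda\in\Lambda\rrbracket$ by the closure of the ideal generated by $x_0$ and all $x_{\lambda+\mu}-(x_\lambda+x_\mu-\beta x_\lambda x_\mu)$; it is isomorphic to $\mathbb Z[\beta]\llbracket x_{y_1},\dots,x_{y_n}\rrbracket$. $W$ acts by $w(x_\lambda)=x_{w(\lambda)}$, trivially on the extra variable $x_q$. **Connective motivic Chern classes.** On $\bigoplus_{\mu\in\Gamma}\mathrm{Frac}(\mathbb Z[\beta]\llbracket\Lambda\rrbracket_{F_C}\llbracket x_q\rrbracket)$ put $$(\partial_i f)|_\mu=(1-x_q^2)\Bigl(\tfrac{f|_\mu}{x_{-\alpha_i}}+\tfrac{r_i(f|_{r_i\mu})}{x_{\alpha_i}}\Bigr)+x_q^2\,r_i(f|_{r_i\mu}).$$ These satisfy the braid relations, giving $\partial_w$ for $w\in W$. $\mathrm{St}_{w_0}|_{w_0}=\prod_{\alpha\in\Sigma_\Theta^+}x_{-\alpha}$, $\mathrm{St}_{w_0}|_\mu=0$ for $\mu\neq w_0$, and $\mathrm{St}_\lambda:=\partial_{w_\lambda}(\mathrm{St}_{w_0})$. *)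

(* Defs.v *)
From HB Require Import structures.
From mathcomp Require Import all_boot all_order all_fingroup all_algebra.
From mathcomp Require Import generic_quotient boolp.
From mathcomp Require Import mpoly ring zify.

Set Implicit Arguments.
Unset Strict Implicit.
Unset Printing Implicit Defensive.

Import Order.TTheory GRing.Theory.

Local Open Scope ring_scope.


Record mpseries (R : Type) (n : nat) := MPSeries { mps_coef :> 'X_{1..n} -> R }.

Notation "{ 'series' R [ n ] }" := (mpseries R n)
  (at level 0, R at level 2, n at level 2, format "{ 'series'  R [ n ] }").

HB.instance Definition _ (R : Type) n := gen_eqMixin {series R[n]}.
HB.instance Definition _ (R : Type) n := gen_choiceMixin {series R[n]}.

Lemma mpsP (R : Type) n (f g : {series R[n]}) : f =1 g -> f = g.
Proof. by case: f g => [f] [g] /= /funext ->. Qed.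

Section SeriesZmod.
Variables (R : zmodType) (n : nat).
Implicit Types f g h : {series R[n]}.

Definition mps_zero : {series R[n]} := MPSeries (fun=> 0).
Definition mps_opp f : {series R[n]} := MPSeries (fun m => - f m).
Definition mps_add f g : {series R[n]} := MPSeries (fun m => f m + g m).

Fact mps_addA : associative mps_add.
Proof. by move=> f g h; apply: mpsP => m; apply: addrA. Qed.
Fact mps_addC : commutative mps_add.
Proof. by move=> f g; apply: mpsP => m; apply: addrC. Qed.
Fact mps_add0 : left_id mps_zero mps_add.
Proof. by move=> f; apply: mpsP => m; apply: add0r. Qed.
Fact mps_addN : left_inverse mps_zero mps_opp mps_add.
Proof. by move=> f; apply: mpsP => m; apply: addNr. Qed.

HB.instance Definition _ :=
  GRing.isZmodule.Build {series R[n]} mps_addA mps_addC mps_add0 mps_addN.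

Lemma mps0E m : (0 : {series R[n]}) m = 0. Proof. by []. Qed.
Lemma mpsDE f g m : (f + g) m = f m + g m. Proof. by []. Qed.
Lemma mpsNE f m : (- f) m = - f m. Proof. by []. Qed.
Lemma mpsBE f g m : (f - g) m = f m - g m. Proof. by []. Qed.

End SeriesZmod.

Section SeriesRing.
Variables (R : comNzRingType) (n : nat).
Implicit Types f g h : {series R[n]}.

Definition mps_one : {series R[n]} := MPSeries (fun m => (m == 0%MM)%:R).
Definition mps_mul f g : {series R[n]} := MPSeries (fun m =>
  \sum_(k : 'X_{1..n < (mdeg m).+1, (mdeg m).+1} | m == (k.1 + k.2)%MM)
     f k.1 * g k.2).

(* The ring axioms are transferred from polynomials, degree by degree. *)
Definition mps_agree (D : nat) f (p : {mpoly R[n]}) :=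
  forall m, (mdeg m < D)%N -> f m = p@_m.

Definition mps_trunc (D : nat) f : {mpoly R[n]} :=
  \sum_(m : 'X_{1..n < D}) f m *: 'X_[m].

Lemma mps_truncP D f : mps_agree D f (mps_trunc D f).
Proof. by move=> m ltmD; rewrite mcoeff_mpoly. Qed.

Lemma mps_agreeM D f g p q :
  mps_agree D f p -> mps_agree D g q -> mps_agree D (mps_mul f g) (p * q).
Proof.
move=> fp gq m ltmD /=; rewrite mcoeffM; apply: eq_bigr => -[k1 k2] /= _.
by rewrite fp ?gq //; apply: leq_ltn_trans ltmD; rewrite -ltnS bmdeg.
Qed.

Lemma mps_agreeD D f g p q :
  mps_agree D f p -> mps_agree D g q -> mps_agree D (f + g) (p + q).
Proof. by move=> fp gq m ltmD; rewrite mpsDE mcoeffD fp ?gq. Qed.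

Lemma mps_agreeN D f p : mps_agree D f p -> mps_agree D (- f) (- p).
Proof. by move=> fp m ltmD; rewrite mpsNE mcoeffN fp. Qed.

Lemma mps_agree1 D : mps_agree D mps_one 1.
Proof. by move=> m _; rewrite mcoeff1. Qed.

Lemma mps_agree_inj f g :
  (forall D, exists2 p, mps_agree D f p & mps_agree D g p) -> f = g.
Proof.
move=> fg; apply: mpsP => m; have [p fp gp] := fg (mdeg m).+1.
by rewrite fp ?gp.
Qed.

Let T D f := @mps_truncP D f.

Fact mps_mulA : associative mps_mul.
Proof.
move=> f g h; apply: mps_agree_inj => D.
exists (mps_trunc D f * (mps_trunc D g * mps_trunc D h)).
  exact: mps_agreeM (T _) (mps_agreeM (T _) (T _)).
by rewrite mulrA; apply: mps_agreeM (mps_agreeM (T _) (T _)) (T _).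
Qed.
Fact mps_mulC : commutative mps_mul.
Proof.
move=> f g; apply: mps_agree_inj => D; exists (mps_trunc D f * mps_trunc D g).
  exact: mps_agreeM (T _) (T _).
by rewrite mulrC; apply: mps_agreeM (T _) (T _).
Qed.
Fact mps_mul1 : left_id mps_one mps_mul.
Proof.
move=> f; apply: mps_agree_inj => D; exists (mps_trunc D f) => //.
by rewrite -[mps_trunc D f]mul1r; apply: mps_agreeM (@mps_agree1 D) (T _).
Qed.
Fact mps_mulDl : left_distributive mps_mul +%R.
Proof.
move=> f g h; apply: mps_agree_inj => D.
exists ((mps_trunc D f + mps_trunc D g) * mps_trunc D h).
  exact: mps_agreeM (mps_agreeD (T _) (T _)) (T _).
by rewrite mulrDl; apply: mps_agreeD; apply: mps_agreeM (T _) (T _).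
Qed.
Fact mps_one_neq0 : mps_one != 0.
Proof.
apply/eqP => /(congr1 (fun f : {series R[n]} => f 0%MM)) /=.
by rewrite eqxx; apply/eqP; rewrite oner_neq0.
Qed.

HB.instance Definition _ := GRing.Zmodule_isComNzRing.Build {series R[n]}
  mps_mulA mps_mulC mps_mul1 mps_mulDl mps_one_neq0.

Lemma mpsME f g m :
  (f * g) m =
  \sum_(k : 'X_{1..n < (mdeg m).+1, (mdeg m).+1} | m == (k.1 + k.2)%MM)
     f k.1 * g k.2.
Proof. by []. Qed.

Lemma mps1E m : (1 : {series R[n]}) m = (m == 0%MM)%:R.
Proof. by []. Qed.

Definition mps_unit : {pred {series R[n]}} := fun f => `[< exists g, g * f = 1 >].
Definition mps_inv f : {series R[n]} :=
  if pselect (exists g, g * f = 1) is left ex then sval (cid ex) else f.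

Fact mps_mulVx : {in mps_unit, left_inverse 1 mps_inv *%R}.
Proof.
move=> f; rewrite unfold_in /mps_inv => /asboolP ex.
by case: pselect => // ex'; case: cid.
Qed.
Fact mps_unitP f g : g * f = 1 -> mps_unit f.
Proof. by move=> gf; apply/asboolP; exists g. Qed.
Fact mps_inv_out : {in [predC mps_unit], mps_inv =1 id}.
Proof.
move=> f; rewrite inE unfold_in /mps_inv => /negP nU.
by case: pselect => // ex; case: nU; apply/asboolP.
Qed.

HB.instance Definition _ := GRing.ComNzRing_hasMulInverse.Build {series R[n]}
  mps_mulVx mps_unitP mps_inv_out.

Definition mps_const (c : R) : {series R[n]} :=
  MPSeries (fun m => c *+ (m == 0%MM)).
Definition mps_var (i : 'I_n) : {series R[n]} :=
  MPSeries (fun m => (m == U_(i)%MM)%:R).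

Lemma mps_geom f : f 0%MM = 0 -> 1 - f \is a GRing.unit.
Proof.
move=> f0; pose P D k := mps_trunc D f ^+ k.
have P0 D k m : (mdeg m < k)%N -> (P D.+1 k)@_m = 0.
  elim: k m => // k IH m ltmk; rewrite /P exprS mcoeffM big1 // => -[k1 k2] /=.
  move=> /eqP def_m; have [k10|k1_neq0] := eqVneq (bmnm k1) 0%MM.
    by rewrite k10 -mps_truncP ?mdeg0 // f0 mul0r.
  have dm : mdeg m = (mdeg k1 + mdeg k2)%N by rewrite [in LHS]def_m mdegD.
  have k1_gt0 : (0 < mdeg k1)%N by rewrite lt0n mdeg_eq0.
  rewrite [X in _ * X]IH ?mulr0 // -ltnS; apply: leq_trans ltmk.
  suff gtD a b c : c = (a + b)%N -> (0 < a)%N -> (b < c)%N by exact: gtD dm k1_gt0.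
  by case: a => // a -> _; rewrite addSn ltnS leq_addl.
pose g : {series R[n]} :=
  MPSeries (fun m => (\sum_(k < (mdeg m).+1) P (mdeg m).+1 k)@_m).
have agP D k : mps_agree D (f ^+ k) (P D k).
  elim: k => [|k IH]; first by rewrite /P !expr0; apply: mps_agree1.
  by rewrite /P !exprS; apply: mps_agreeM IH; apply: mps_truncP.
have agg D : mps_agree D g (\sum_(k < D) P D k).
  move=> m ltmD /=; rewrite !raddf_sum /=.
  transitivity (\sum_(k < (mdeg m).+1) (P D k)@_m).
    by apply: eq_bigr => k _; rewrite -!agP.
  rewrite (big_ord_widen D (fun k => (P D k)@_m)) // [RHS](bigID (fun k : 'I_D => k < (mdeg m).+1)%N) /=.
  rewrite [X in _ = _ + X]big1 ?addr0 // => k; rewrite -leqNgt => ltmk.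
  by case: D ltmD k ltmk => // D _ k ltmk; apply: P0.
apply/asboolP; exists g; apply: mps_agree_inj => D.
exists ((\sum_(k < D) P D k) * (1 - mps_trunc D f)).
  apply: mps_agreeM (agg _) _; apply: mps_agreeD (@mps_agree1 D) _.
  by apply: mps_agreeN; apply: mps_truncP.
move=> m ltmD; rewrite mulrC.
have -> : (1 - mps_trunc D f) * (\sum_(k < D) P D k) = 1 - P D D.
  by rewrite /P -[1 in RHS](expr1n _ D) subrXX; congr (_ * _);
     apply: eq_bigr => k _; rewrite expr1n mul1r.
case: D ltmD => // D ltmD.
by rewrite mcoeffB P0 // subr0 mcoeff1 mps1E.
Qed.

End SeriesRing.

Section SeriesConst.
Variables (R : comNzRingType) (n : nat).

Fact mps_const_zmod_morphism : zmod_morphism (@mps_const R n).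
Proof. by move=> a b; apply: mpsP => m; rewrite mpsBE /= mulrnBl. Qed.
HB.instance Definition _ := GRing.isZmodMorphism.Build R {series R[n]}
  (@mps_const R n) mps_const_zmod_morphism.

Lemma mps_constM_coef (a : R) (f : {series R[n]}) m :
  (mps_const n a * f) m = a * f m.
Proof.
have ac : mps_agree (mdeg m).+1 (mps_const n a) a%:MP.
  by move=> k _ /=; rewrite mcoeffC mulr_natr.
have /(_ m (ltnSn _)) := mps_agreeM ac (@mps_truncP _ _ (mdeg m).+1 f).
by rewrite mcoeffCM -mps_truncP.
Qed.

Fact mps_const_monoid_morphism : monoid_morphism (@mps_const R n).
Proof.
split=> [|a b]; apply: mpsP => m //.
by rewrite mps_constM_coef /= mulrnAr.
Qed.
HB.instance Definition _ := GRing.isMonoidMorphism.Build R {series R[n]}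
  (@mps_const R n) mps_const_monoid_morphism.

End SeriesConst.

Section SeriesDomain.
Variables (R : idomainType) (n : nat).
Implicit Types f g : {series R[n]}.

Lemma mps_order f : f != 0 ->
  exists2 m, f m != 0 & forall k, (k < m)%O -> f k = 0.
Proof.
move=> f_neq0; apply: contrapT => noMin; case/eqP: f_neq0; apply: mpsP => m.
elim/(well_founded_ind (@ltom_wf n)): m => m IH; apply/eqP/negPn/negP => fm.
by apply: noMin; exists m.
Qed.

Fact mps_mulf_eq0 : GRing.integral_domain_axiom {series R[n]}.
Proof.
move=> f g fg0; apply/norP => -[/mps_order [a fa a_min] /mps_order [b gb b_min]].
have: (f * g) (a + b)%MM = f a * g b.
  have lta : (mdeg a < (mdeg (a + b)).+1)%N by rewrite mdegD ltnS leq_addr.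
  have ltb : (mdeg b < (mdeg (a + b)).+1)%N by rewrite mdegD ltnS leq_addl.
  rewrite mpsME (bigD1 (BMultinom lta, BMultinom ltb)) //= big1 ?addr0 //.
  move=> [k1 k2] /= /andP[/eqP def_ab neq].
  case: (ltgtP (bmnm k1) a) => [/a_min-> |ltak|eqk1].
  - by rewrite mul0r.
  - rewrite (b_min k2) ?mulr0 // ltNge; apply/negP => lebk.
    by have := ltmc_le_add ltak lebk; rewrite -def_ab ltxx.
  case/eqP: neq; congr (_, _); apply: val_inj => //=.
  apply/eqP; rewrite -(eqm_add2l (bmnm k1)) -def_ab eqk1; exact: eqxx.
by rewrite fg0 mps0E => /esym/eqP; rewrite mulf_eq0 (negbTE fa) (negbTE gb).
Qed.

HB.instance Definition _ :=
  GRing.ComUnitRing_isIntegral.Build {series R[n]} mps_mulf_eq0.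

End SeriesDomain.

Section SeriesMap.
Variables (R S : comNzRingType) (n : nat) (phi : {rmorphism R -> S}).

Definition mps_map (f : {series R[n]}) : {series S[n]} :=
  MPSeries (fun m => phi (f m)).

Fact mps_map_zmod_morphism : zmod_morphism mps_map.
Proof. by move=> f g; apply: mpsP => m; rewrite mpsBE /= rmorphB. Qed.
HB.instance Definition _ := GRing.isZmodMorphism.Build {series R[n]}
  {series S[n]} mps_map mps_map_zmod_morphism.

Fact mps_map_monoid_morphism : monoid_morphism mps_map.
Proof.
split=> [|f g]; apply: mpsP => m; first by rewrite mps1E /= rmorph_nat.
by rewrite /= rmorph_sum; apply: eq_bigr => k _; rewrite rmorphM.
Qed.
HB.instance Definition _ := GRing.isMonoidMorphism.Build {series R[n]}
  {series S[n]} mps_map mps_map_monoid_morphism.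

Lemma mps_map_inj : injective phi -> injective mps_map.
Proof.
move=> phiI f g fg; apply: mpsP => m; apply: phiI.
by have /(congr1 (fun h : {series S[n]} => h m)) := fg.
Qed.

End SeriesMap.

Section SeriesPerm.
Variables (R : comNzRingType) (n : nat) (w : 'S_n).

(* The continuous R-algebra map sending the variable i to the variable w i. *)
Definition mps_perm (f : {series R[n]}) : {series R[n]} :=
  MPSeries (fun m => f [multinom m (w i) | i < n]).

Lemma mps_perm_agree D f p :
  mps_agree D f p -> mps_agree D (mps_perm f) (msym w p).
Proof.
by move=> fp m ltmD; rewrite mcoeff_sym -fp ?mdeg_mperm.
Qed.

Fact mps_perm_zmod_morphism : zmod_morphism mps_perm.
Proof. by move=> f g; apply: mpsP => m; rewrite mpsBE. Qed.
HB.instance Definition _ := GRing.isZmodMorphism.Build {series R[n]}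
  {series R[n]} mps_perm mps_perm_zmod_morphism.

Fact mps_perm_monoid_morphism : monoid_morphism mps_perm.
Proof.
split=> [|f g]; apply: mps_agree_inj => D.
  exists 1; last exact: mps_agree1.
  by rewrite -(rmorph1 (msym w)); apply: mps_perm_agree; apply: mps_agree1.
exists (msym w (mps_trunc D f * mps_trunc D g)).
  by apply: mps_perm_agree; apply: mps_agreeM; apply: mps_truncP.
rewrite rmorphM; apply: mps_agreeM; apply: mps_perm_agree; exact: mps_truncP.
Qed.
HB.instance Definition _ := GRing.isMonoidMorphism.Build {series R[n]}
  {series R[n]} mps_perm mps_perm_monoid_morphism.

Lemma mps_perm_var i : mps_perm (mps_var R i) = mps_var R (w i).
Proof.
apply: mpsP => m /=; congr (nat_of_bool _)%:R; apply/eqP/eqP => /mnmP E.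
  apply/mnmP => k; have := E ((w^-1)%g k).
  by rewrite mnmE permKV !mnm1E => ->; rewrite -(inj_eq (@perm_inj _ w)) permKV.
by apply/mnmP => k; rewrite mnmE E !mnm1E (inj_eq (@perm_inj _ w)).
Qed.

Lemma mps_perm_const c : mps_perm (mps_const n c) = mps_const n c.
Proof.
apply: mpsP => m /=; congr (_ *+ nat_of_bool _); apply/eqP/eqP => /mnmP E.
  by apply/mnmP => k; have := E ((w^-1)%g k); rewrite mnmE permKV !mnm0E.
by apply/mnmP => k; rewrite mnmE E !mnm0E.
Qed.

Lemma mps_perm_inj : injective mps_perm.
Proof.
move=> f g fg; apply: mpsP => m.
have /(congr1 (fun h : {series R[n]} => h [multinom m ((w^-1)%g i) | i < n])) := fg.
move=> /=; suff -> : [multinom [multinom m ((w^-1)%g i) | i < n] (w i) | i < n] = m by [].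
by apply/mnmP => i; rewrite !mnmE permK.
Qed.

End SeriesPerm.

(* Extension to the fraction field; meaningful for injective ring morphisms,
   for which the choice of numerator and denominator is irrelevant. *)
Section FracMap.
Variable S : idomainType.

Definition frac_map (phi : S -> S) (u : {fraction S}) : {fraction S} :=
  tofrac (phi (\n_(repr u))) / tofrac (phi (\d_(repr u))).

Lemma frac_numden (u : {fraction S}) :
  u = tofrac (\n_(repr u)) / tofrac (\d_(repr u)).
Proof.
have d_neq0 : tofrac (\d_(repr u)) != 0 by rewrite tofrac_eq0 denom_ratioP.
apply: (mulIf d_neq0); rewrite divfK //.
rewrite -{1}[u]reprK; move: (repr u) => x.
unlock FracField.tofrac; rewrite !piE.
apply/eqP; rewrite eqmodE /= FracField.equivfE /FracField.mulf.
rewrite !numden_Ratio ?mulr1 ?oner_neq0 ?denom_ratioP //.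
by rewrite mulrC.
Qed.

Lemma frac_map_div (phi : {rmorphism S -> S}) a b :
  injective phi -> b != 0 ->
  frac_map phi (tofrac a / tofrac b) = tofrac (phi a) / tofrac (phi b).
Proof.
move=> phiI b_neq0; set u := _ / _; rewrite /frac_map.
have phi_neq0 c : c != 0 -> tofrac (phi c) != 0.
  by rewrite tofrac_eq0 -(inj_eq phiI) rmorph0.
have dneq0 := denom_ratioP (repr u).
apply/eqP; rewrite eqr_div ?phi_neq0 // -!rmorphM tofrac_eq; apply/eqP; congr (phi _).
apply/eqP; rewrite -tofrac_eq !rmorphM -eqr_div ?tofrac_eq0 //.
by rewrite -frac_numden.
Qed.

End FracMap.

Section ConnectiveFGL.
Variables (S : comUnitRingType) (b : S).
Implicit Types x y z : S.

Definition fgl_add x y := x + y - b * x * y.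
Definition fgl_opp x := - x / (1 - b * x).
Definition fgl_mulz x (k : int) :=
  match k with
  | Posz m => iter m (fgl_add x) 0
  | Negz m => fgl_opp (iter m.+1 (fgl_add x) 0)
  end.

Fact fgl_addA : associative fgl_add.
Proof. by move=> x y z; rewrite /fgl_add; ring. Qed.
Fact fgl_addC : commutative fgl_add.
Proof. by move=> x y; rewrite /fgl_add; ring. Qed.
Fact fgl_add0 : left_id 0 fgl_add.
Proof. by move=> x; rewrite /fgl_add; ring. Qed.
HB.instance Definition _ :=
  Monoid.isComLaw.Build S 0 fgl_add fgl_addA fgl_addC fgl_add0.

Definition fgl_ok x := 1 - b * x \is a GRing.unit.

Lemma fgl_ok0 : fgl_ok 0.
Proof. by rewrite /fgl_ok mulr0 subr0 unitr1. Qed.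

Lemma fgl_ok_add x y : fgl_ok (fgl_add x y) = fgl_ok x && fgl_ok y.
Proof.
rewrite /fgl_ok -unitrM; congr (_ \is a _); rewrite /fgl_add; ring.
Qed.

Lemma fgl_addN x : fgl_ok x -> fgl_add x (fgl_opp x) = 0.
Proof.
move=> xU; rewrite /fgl_opp; set v := (1 - b * x)^-1.
have vU : (1 - b * x) * v = 1 by rewrite divrr.
transitivity (x * (1 - (1 - b * x) * v)); first by rewrite /fgl_add; ring.
by rewrite vU subrr mulr0.
Qed.

Lemma fgl_ok_iter x m : fgl_ok x -> fgl_ok (iter m (fgl_add x) 0).
Proof.
by move=> xU; elim: m => [|m IH] /=; rewrite ?fgl_ok0 ?fgl_ok_add ?xU.
Qed.

Lemma fgl_mulzS x k : fgl_ok x ->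
  fgl_mulz x (k + 1) = fgl_add x (fgl_mulz x k).
Proof.
move=> xU; case: k => [m|[|m]]; first by rewrite -PoszD addn1.
  by rewrite /= [fgl_add x 0]fgl_addC fgl_add0 fgl_addN.
have -> : Negz m.+1 + 1 = Negz m by rewrite !NegzE (intS m.+1); ring.
pose z := iter m.+1 (fgl_add x) 0; pose z1 := fgl_add x z.
change (fgl_opp z = fgl_add x (fgl_opp z1)).
have zU : fgl_ok z by apply: fgl_ok_iter.
have z1U : fgl_ok z1 by rewrite /z1 fgl_ok_add xU.
clearbody z; rewrite -[LHS]fgl_add0 -(fgl_addN z1U) [fgl_add z1 _]fgl_addC /z1.
rewrite -!fgl_addA (fgl_addN zU) [fgl_add x 0]fgl_addC fgl_add0.
by rewrite fgl_addC.
Qed.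

Lemma fgl_mulzD x k l : fgl_ok x ->
  fgl_mulz x (k + l) = fgl_add (fgl_mulz x k) (fgl_mulz x l).
Proof.
move=> xU; elim/int_rect: l => [|m IH|m IH].
- by rewrite addr0 /= fgl_addC fgl_add0.
- by rewrite intS [1 + _]addrC addrA fgl_mulzS // IH fgl_mulzS // fgl_addA
     [fgl_add x _]fgl_addC -fgl_addA.
have pred t : fgl_mulz x t = fgl_add x (fgl_mulz x (t - 1)).
  by rewrite -fgl_mulzS // subrK.
have xI : injective (fgl_add x).
  move=> y z /(congr1 (fgl_add (fgl_opp x))).
  by rewrite !fgl_addA [fgl_add (fgl_opp x) x]fgl_addC fgl_addN // !fgl_add0.
apply: xI; rewrite intS opprD addrA.
have -> : k - 1 - m%:Z = (k - m%:Z) - 1 by ring.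
rewrite -pred IH [in LHS](pred (- m%:Z)) -[- 1 - _]addrC.
by rewrite !fgl_addA [fgl_add x (fgl_mulz x k)]fgl_addC.
Qed.

End ConnectiveFGL.

(* The basis y_1, ..., y_n is indexed by 'I_n: y_ i stands for y_{i+1}. *)

Definition lattice (n : nat) := {ffun 'I_n -> int}.
HB.instance Definition _ n := GRing.Zmodule.on (lattice n).

Definition y_ (n : nat) (i : 'I_n) : lattice n := [ffun k => (k == i)%:Z].

Definition lat_act (n : nat) (w : 'S_n) (l : lattice n) : lattice n :=
  [ffun k => l ((w^-1)%g k)].

(* Z[beta] is {poly int}, and Z[beta][[Lambda]]_F is identified with the power
   series ring in x_{y_1}, ..., x_{y_n}, where x_lambda is the formal sum of the
   lambda_i-fold formal multiples of x_{y_i}; see x_0, x_D and x_y below for the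
   defining relations, and fga_act_x for the action w(x_lambda) = x_{w lambda}. *)
Notation FGA n := {series {poly int}[n]}.

Definition beta (n : nat) : FGA n := mps_const n 'X.

Definition x_ (n : nat) (l : lattice n) : FGA n :=
  \big[fgl_add (beta n)/0]_(i < n) fgl_mulz (beta n) (mps_var _ i) (l i).

Lemma fga_var_ok n (i : 'I_n) : fgl_ok (beta n) (mps_var _ i).
Proof.
apply: mps_geom; rewrite /beta mps_constM_coef /= eq_sym mnm1_eq0 mulr0 //.
Qed.

Lemma x_0 n : x_ (0 : lattice n) = 0.
Proof. by rewrite /x_ big1 // => i _; rewrite ffunE. Qed.

Lemma x_D n (l m : lattice n) : x_ (l + m) = fgl_add (beta n) (x_ l) (x_ m).
Proof.
rewrite /x_ -big_split; apply: eq_bigr => i _.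
by rewrite ffunE fgl_mulzD //; apply: fga_var_ok.
Qed.

Lemma x_y n (i : 'I_n) : x_ (y_ i) = mps_var _ i.
Proof.
rewrite /x_ (bigD1 i) //= big1 => [|k /negPf ki]; rewrite ffunE ?eqxx ?ki //.
by rewrite /= /fgl_add; ring.
Qed.

Lemma fga_act_x n (w : 'S_n) (l : lattice n) :
  mps_perm w (x_ l) = x_ (lat_act w l).
Proof.
have addE (p q : FGA n) : mps_perm w (fgl_add (beta n) p q) =
    fgl_add (beta n) (mps_perm w p) (mps_perm w q).
  by rewrite /fgl_add rmorphB rmorphD !rmorphM /= mps_perm_const.
have iterE m p : mps_perm w (iter m (fgl_add (beta n) p) 0) =
    iter m (fgl_add (beta n) (mps_perm w p)) 0.
  by elim: m => [|m IH] /=; rewrite ?rmorph0 // addE IH.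
have oppE p : fgl_ok (beta n) p ->
    mps_perm w (fgl_opp (beta n) p) = fgl_opp (beta n) (mps_perm w p).
  rewrite /fgl_ok /fgl_opp => pU; rewrite rmorphM (rmorphN (mps_perm w)).
  by rewrite rmorphV // rmorphB rmorph1 rmorphM /= mps_perm_const.
rewrite /x_ (big_morph _ addE (rmorph0 _)) [RHS](reindex_inj (@perm_inj _ w)) /=.
apply: eq_bigr => i _; rewrite ffunE permK -mps_perm_var.
case: (l i) => m /=; first exact: iterE.
have okm : fgl_ok (beta n) (iter m.+1 (fgl_add (beta n) (mps_var _ i)) 0).
  by apply: fgl_ok_iter; apply: fga_var_ok.
by rewrite -!iterS oppE // iterE.
Qed.

(* Z[beta][[Lambda]]_F[[x_q]] and its fraction field; W fixes x_q. *)
Notation FGAq n := {series (FGA n)[1]}.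
Notation FracFGAq n := {fraction FGAq n}.

Definition xq (n : nat) : FGAq n := mps_var _ ord0.
Definition xFGAq (n : nat) (l : lattice n) : FGAq n := mps_const _ (x_ l).

Definition fgaq_act (n : nat) (w : 'S_n) : FGAq n -> FGAq n :=
  mps_map (@mps_perm _ n w).
HB.instance Definition _ n (w : 'S_n) := GRing.RMorphism.on (@fgaq_act n w).

Lemma fgaq_act_inj n (w : 'S_n) : injective (@fgaq_act n w).
Proof. by apply: mps_map_inj; apply: mps_perm_inj. Qed.

Lemma fgaq_act_x n (w : 'S_n) l : fgaq_act w (xFGAq l) = xFGAq (lat_act w l).
Proof. by apply: mpsP => m /=; rewrite raddfMn /= fga_act_x. Qed.

Lemma fgaq_act_xq n (w : 'S_n) : fgaq_act w (xq n) = xq n.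
Proof. by apply: mpsP => m /=; rewrite rmorph_nat. Qed.

Definition frac_act (n : nat) (w : 'S_n) : FracFGAq n -> FracFGAq n :=
  frac_map (fgaq_act w).

Lemma frac_act_div n (w : 'S_n) (a b : FGAq n) : b != 0 ->
  frac_act w (tofrac a / tofrac b) = tofrac (fgaq_act w a) / tofrac (fgaq_act w b).
Proof. by move=> b0; rewrite /frac_act frac_map_div //; apply: fgaq_act_inj. Qed.

(* 0 = i_0 < i_1 < ... < i_d < i_{d+1} = n, with i_a = step a. *)

Record flag_type (n d : nat) := FlagType {
  step :> 'I_d.+2 -> nat;
  step_first : step ord0 = 0%N;
  step_last : step ord_max = n;
  step_lt : forall a b : 'I_d.+2, (a < b)%N -> (step a < step b)%N
}.

Section Combinatorics.
Variables (n d : nat) (I : flag_type n d).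

(* part j is p_{j+1} = i_{j+1} - i_j, for j = 0, ..., d. *)
Definition part (j : 'I_d.+1) : nat :=
  (I (lift ord0 j) - I (widen_ord (leqnSn _) j))%N.

(* With 0-based indices, i <= i_m < j becomes i < i_m <= j; the indices m = 0
   and m = d+1 never satisfy this condition. *)
Definition in_SigmaPos (p : 'I_n * 'I_n) : bool :=
  (p.1 < p.2)%N && [exists m : 'I_d.+2, (p.1 < I m <= p.2)%N].

Definition SigmaPos : seq (lattice n) :=
  [seq y_ p.1 - y_ p.2 | p <- enum {: 'I_n * 'I_n} & in_SigmaPos p].

Definition Sigma : seq (lattice n) := SigmaPos ++ [seq - a | a <- SigmaPos].

(* rev_ord j is the letter d + 1 - (j + 1) = d - j. *)
Definition in_Gamma (l : n.-tuple 'I_d.+1) : bool :=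
  [forall j : 'I_d.+1, count_mem (rev_ord j) l == part j].

Definition Gamma := {l : n.-tuple 'I_d.+1 | in_Gamma l}.

Definition word_act (w : 'S_n) (l : n.-tuple 'I_d.+1) : n.-tuple 'I_d.+1 :=
  [tuple tnth l ((w^-1)%g i) | i < n].

Lemma word_actE w l i : tnth (word_act w l) (w i) = tnth l i.
Proof. by rewrite tnth_mktuple permK. Qed.

Lemma word_act_perm w l : perm_eq (word_act w l) l.
Proof. by apply/tuple_permP; exists (w^-1)%g. Qed.

Lemma word_act_Gamma w l : in_Gamma l -> in_Gamma (word_act w l).
Proof.
move=> /forallP lG; apply/forallP => j.
by have /seq.permP -> := word_act_perm w l.
Qed.

Definition Gamma_act (w : 'S_n) (l : Gamma) : Gamma :=
  Sub (word_act w (val l)) (word_act_Gamma w (valP l)).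

Definition w0_seq : seq 'I_d.+1 :=
  flatten [seq nseq (part j) (rev_ord j) | j <- enum 'I_d.+1].

Lemma sum_part : (\sum_(j < d.+1) part j = n)%N.
Proof.
pose g k := I (inord k).
have -> : n = (g d.+1 - g 0)%N.
  rewrite /g; have -> : inord d.+1 = ord_max :> 'I_d.+2.
    by apply: val_inj; rewrite /= inordK.
  have -> : inord 0 = ord0 :> 'I_d.+2 by apply: val_inj; rewrite /= inordK.
  by rewrite step_first step_last subn0.
rewrite -(@telescope_sumn_in 0 d.+1 g) //; last first.
  move=> k /andP[_ ltkd]; apply: ltnW; apply: step_lt.
  by rewrite !inordK // ltnS; lia.
rewrite big_mkord; apply: eq_bigr => j _; rewrite /part /g.
congr (_ - _)%N; congr (step I _); apply: ord_inj.
  by rewrite lift0 inordK // ltnS ltn_ord.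
by rewrite /= inordK // ltnW // ltnS ltn_ord.
Qed.

Lemma size_w0 : size w0_seq == n.
Proof.
rewrite size_flatten /shape -map_comp sumnE big_map -[X in _ == X]sum_part big_enum.
by apply/eqP; apply: eq_bigr => j _; rewrite /= size_nseq.
Qed.

Lemma w0_in_Gamma : in_Gamma (Tuple size_w0).
Proof.
apply/forallP => j; rewrite count_flatten -map_comp sumnE big_map big_enum /=.
rewrite (bigD1 j) //= big1 => [|k kj]; rewrite count_nseq /= ?eqxx ?mul1n ?addn0 //.
by rewrite (inj_eq rev_ord_inj) (negPf kj).
Qed.

Definition w0 : Gamma := Sub (Tuple size_w0) w0_in_Gamma.

Lemma w0_transitive (l : Gamma) : exists w, l = Gamma_act w w0.
Proof.
have /tuple_permP[p lp] : perm_eq (val l) (val w0).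
  apply/allP => /= c _; apply/eqP; rewrite -[c]rev_ordK.
  have /forallP/(_ (rev_ord c))/eqP -> := valP l.
  by have /forallP/(_ (rev_ord c))/eqP -> := valP w0.
have {}lp : val l = [tuple tnth (val w0) (p i) | i < n] by apply: val_inj.
exists (p^-1)%g; apply: val_inj; rewrite lp /=.
by apply: eq_from_tnth => i; rewrite !tnth_mktuple invgK.
Qed.

End Combinatorics.

(* An index i : 'I_n.-1 stands for i+1 in {1, ..., n-1}. *)

Section Coxeter.
Variable n : nat.

Fact lo_subproof (i : 'I_n.-1) : (i < n)%N. Proof. by case: i => i /=; lia. Qed.
Fact hi_subproof (i : 'I_n.-1) : (i.+1 < n)%N. Proof. by case: i => i /=; lia. Qed.
Definition lo (i : 'I_n.-1) : 'I_n := Ordinal (lo_subproof i).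
Definition hi (i : 'I_n.-1) : 'I_n := Ordinal (hi_subproof i).

Definition alpha (i : 'I_n.-1) : lattice n := y_ (lo i) - y_ (hi i).
Definition srefl (i : 'I_n.-1) : 'S_n := tperm (lo i) (hi i).

(* word_perm [:: i1; ...; il] is the composite r_{i1} o ... o r_{il}; recall
   that the product of permutations is (s * t) x = t (s x). *)
Definition word_perm (s : seq 'I_n.-1) : 'S_n :=
  foldr (fun i w => (w * srefl i)%g) 1%g s.

Lemma word_perm_cat s t : word_perm (s ++ t) = (word_perm t * word_perm s)%g.
Proof. by elim: s => [|i s IH] /=; rewrite ?mulg1 // IH mulgA. Qed.

Lemma word_perm_tperm (a b : 'I_n) : exists s, word_perm s = tperm a b.
Proof.
wlog leab : a b / (a <= b)%N.
  by move=> H; case: (leqP a b) => [|/ltnW] /H // [s]; rewrite tpermC; exists s.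
case: b leab => b; elim: b a => [|b IH] a ltb leab.
  exists [::]; rewrite (_ : Ordinal ltb = a) ?tperm1 //.
  by apply: val_inj => /=; move: leab; rewrite leqn0 => /eqP.
have ltb' : (b < n)%N by apply: ltnW.
have ltp : (b < n.-1)%N by lia.
move: leab; rewrite /= leq_eqVlt => /orP[/eqP eqab|].
  by exists [::]; rewrite (_ : Ordinal ltb = a) ?tperm1 //; apply: val_inj.
rewrite ltnS => leab.
have elo : lo (Ordinal ltp) = Ordinal ltb' by apply: val_inj.
have ehi : hi (Ordinal ltp) = Ordinal ltb by apply: val_inj.
have [eqab|neqab] := eqVneq a (Ordinal ltb').
  by exists [:: Ordinal ltp]; rewrite /= mul1g /srefl elo ehi eqab.
have [s def_s] := IH a ltb' leab.
exists ([:: Ordinal ltp] ++ s ++ [:: Ordinal ltp]).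
rewrite !word_perm_cat /= !mul1g def_s /srefl elo ehi.
set t := tperm (Ordinal ltb') _; rewrite -{1}[t]tpermV -mulgA -conjgE tpermJ.
rewrite tpermD ?tpermL // 1?eq_sym //.
by rewrite -val_eqE /=; move: leab => /=; lia.
Qed.

Lemma word_perm_surj (w : 'S_n) : exists s, word_perm s = w.
Proof.
have [ts -> _] := prod_tpermP w.
elim: ts => [|t ts [s def_s]]; first by exists [::]; rewrite big_nil.
have [s1 def_s1] := word_perm_tperm t.1 t.2.
by exists (s ++ s1); rewrite word_perm_cat def_s def_s1 big_cons.
Qed.

Lemma word_length_ex (w : 'S_n) :
  exists k, [exists s : k.-tuple 'I_n.-1, word_perm s == w].
Proof.
have [s def_s] := word_perm_surj w; exists (size s).
by apply/existsP; exists (in_tuple s); rewrite /= def_s.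
Qed.

Definition perm_length (w : 'S_n) : nat := ex_minn (word_length_ex w).

Definition reduced_word (s : seq 'I_n.-1) (w : 'S_n) : bool :=
  (word_perm s == w) && (size s == perm_length w).

Lemma reduced_word_ex w : exists s, reduced_word s w.
Proof.
rewrite /reduced_word /perm_length; case: ex_minnP => k /existsP[s /eqP ws] _.
by exists s; rewrite ws size_tuple !eqxx.
Qed.

End Coxeter.

Section MotivicChern.
Variables (n d : nat) (I : flag_type n d).

(* w_lambda. The default value 1 is never used, see w_minP. *)
Definition w_min (l : Gamma I) : 'S_n :=
  [arg min_(w < 1%g | l == Gamma_act w (w0 I)) perm_length w].

Lemma w_minP (l : Gamma I) : l = Gamma_act (w_min l) (w0 I) /\
  forall w, l = Gamma_act w (w0 I) -> (perm_length (w_min l) <= perm_length w)%N.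
Proof.
rewrite /w_min; have [v lv] := w0_transitive l.
have Pv : l == Gamma_act v (w0 I) by apply/eqP.
rewrite (_ : arg_min _ _ _ = [arg min_(w < v | l == Gamma_act w (w0 I)) perm_length w]).
  by case: arg_minnP => // w /eqP lw w_min; split=> // u /eqP /w_min.
rewrite /arg_min /extremum; case: pickP => //= noMin.
case: (@arg_minnP _ v (fun w => l == Gamma_act w (w0 I)) (@perm_length n) Pv) => w Pw w_min.
have := noMin w; rewrite /= Pw => /negbT/forallPn[u].
by rewrite negb_imply => /andP[/w_min ->].
Qed.

Local Notation Frac := (FracFGAq n).

Definition xF (l : lattice n) : Frac := tofrac (xFGAq l).
Definition xqF : Frac := tofrac (xq n).

Definition DL (i : 'I_n.-1) (f : Gamma I -> Frac) : Gamma I -> Frac :=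
  fun mu =>
    (1 - xqF ^+ 2) * (f mu / xF (- alpha i)
       + frac_act (srefl i) (f (Gamma_act (srefl i) mu)) / xF (alpha i))
    + xqF ^+ 2 * frac_act (srefl i) (f (Gamma_act (srefl i) mu)).

Definition DL_word (s : seq 'I_n.-1) (f : Gamma I -> Frac) : Gamma I -> Frac :=
  foldr DL f s.

Definition St_w0 : Gamma I -> Frac :=
  fun mu => if mu == w0 I then \prod_(a <- SigmaPos I) xF (- a) else 0.

(* f is St_lambda, computed from a reduced word of w_lambda. Since the braid
   relations are not established here, no reduced word is singled out. *)
Definition is_St (l : Gamma I) (f : Gamma I -> Frac) : Prop :=
  exists2 s, reduced_word s (w_min l) & f = DL_word s St_w0.

Lemma is_St_ex l : exists f, is_St l f.
Proof. by have [s sP] := reduced_word_ex (w_min l); exists (DL_word s St_w0), s. Qed.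

End MotivicChern.

(* Main.v *)
Require Import Defs.
From HB Require Import structures.
From mathcomp Require Import all_boot all_order all_fingroup all_algebra.
From mathcomp Require Import boolp mpoly ring zify.

Set Implicit Arguments.
Unset Strict Implicit.
Unset Printing Implicit Defensive.

Import GRing.Theory.

Local Open Scope ring_scope.

(** Write X_a for x_{y_a}.  Call a family f = (f_mu) of power series GKM when
    f_mu - f_{(a b) mu} is divisible by x_{y_a - y_b} for all a <> b and mu.
    The theorem follows by induction on a word: the starting family St_{w_0}
    is integral and GKM, and every operator partial_i sends integral GKM
    families to integral GKM families.

    Starting family.  Only the component at w_0 is nonzero.  If (a b) moves
    w_0, then a and b lie in different blocks, so y_a - y_b is, up to sign, in
    Sigma_Theta^+, and x_{y_a - y_b} divides the product that defines this
    component (w0_moved_SigmaPos, GKM_class_w0).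

    Induction step (DL_GKM).  Put r = r_i, x = x_{alpha_i}.  The relation
    F(x, x_{-alpha_i}) = 0 gives 1 / x_{-alpha_i} = beta - 1 / x, hence
      (partial_i f)_mu = (1 - x_q^2) (c_mu + beta f_mu)
                         + x_q^2 r(f_{r mu}),
    where c_mu = (r(f_{r mu}) - f_mu) / x.  Since r acts trivially modulo x
    (divides_tperm) and f is GKM, c_mu is a power series.  It remains to see
    that c is GKM.
    - For a transposition (a b) <> r, x times c_mu - c_{(a b) mu} is divisible
      by x_{y_a - y_b} because f and its r-twist are GKM; the factor x cancels
      because non-proportional roots are coprime (divides_root_cancel).
    - For (a b) = r, applying r to x c_mu = r(f_{r mu}) - f_mu yields
      r(c_mu) = (1 - beta x) c_{r mu}, so
      c_mu = r(c_mu) = c_{r mu} modulo x (GKM_quotient).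

    The two facts about divisibility reduce to X_a - X_b, an associate of
    x_{y_a - y_b} (divides_x_root).  Modulo X_a - X_b every series is congruent
    to a unique one without X_a, the result of substituting X_b for X_a
    (subst_var_modulo, divides_free).  This normal form is invariant under the
    exchange of X_a and X_b, and multiplication by X_c - X_e with c, e <> a
    preserves the series without X_a. *)

(** * Divisibility *)

Definition divides (R : comNzRingType) (a f : R) : Prop := exists h, f = a * h.

Section Divides.
Variable R : comNzRingType.
Implicit Types a b f g : R.

Lemma divides0 a : divides a 0.
Proof. by exists 0; rewrite mulr0. Qed.

Lemma dividesD a f g : divides a f -> divides a g -> divides a (f + g).
Proof. by move=> [x ->] [y ->]; exists (x + y); rewrite mulrDr. Qed.

Lemma dividesN a f : divides a f -> divides a (- f).
Proof. by move=> [x ->]; exists (- x); rewrite mulrN. Qed.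

Lemma dividesB a f g : divides a f -> divides a g -> divides a (f - g).
Proof. by move=> af /dividesN; apply: dividesD. Qed.

Lemma divides_mulr a f g : divides a f -> divides a (f * g).
Proof. by move=> [x ->]; exists (x * g); rewrite mulrA. Qed.

Lemma divides_mull a f g : divides a f -> divides a (g * f).
Proof. by rewrite mulrC; apply: divides_mulr. Qed.

Lemma divides_self a : divides a a.
Proof. by exists 1; rewrite mulr1. Qed.

Lemma divides_trans a b f : divides a b -> divides b f -> divides a f.
Proof. by move=> ab [x ->]; apply: divides_mulr. Qed.

End Divides.

Lemma divides_morph (R S : comNzRingType) (phi : {rmorphism R -> S}) a f :
  divides a f -> divides (phi a) (phi f).
Proof. by move=> [h ->]; exists (phi h); rewrite rmorphM. Qed.

(** A constant divisor acts coefficientwise; this brings divisibility by a root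
    down from the series in x_q to their coefficients. *)
Lemma divides_const (R : comNzRingType) n (a : R) (f : {series R[n]}) :
  divides (mps_const n a) f <-> forall m, divides a (f m).
Proof.
split=> [[h ->] m|af]; first by exists (h m); rewrite mps_constM_coef.
have [h fE] := choice af.
by exists (MPSeries h); apply: mpsP => m; rewrite mps_constM_coef fE.
Qed.

(** * Power series modulo a difference of two variables *)

Section VariableDifference.
Variables (R : idomainType) (n : nat).
Implicit Types (f g h : {series R[n]}) (a b c e : 'I_n) (m : 'X_{1..n}).

Local Notation X a := (mps_var R a).

Lemma mps_varM_coef c f m :
  (X c * f) m = if (0 < m c)%N then f (m - U_(c))%MM else 0.
Proof.
rewrite mpsME; case: ltnP => [m_gt0|m_le0]; last first.
  rewrite big1 // => -[k1 k2] /= /eqP mE.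
  case: eqP => [k1E|_]; last by rewrite mul0r.
  have := congr1 (fun u : 'X_{1..n} => u c) mE.
  by rewrite /= mnmDE k1E mnm1E eqxx; move: m_le0 => /[swap] ->.
have mE : m = (U_(c) + (m - U_(c)))%MM.
  by rewrite addmC submK //; apply/mnm_lepP => i; rewrite mnm1E; case: eqP => // <-.
have lt1 : (mdeg (U_(c) : 'X_{1..n}) < (mdeg m).+1)%N.
  by rewrite ltnS [leqRHS](congr1 mdeg mE) mdegD leq_addr.
have lt2 : (mdeg (m - U_(c)) < (mdeg m).+1)%N.
  by rewrite ltnS [leqRHS](congr1 mdeg mE) mdegD leq_addl.
rewrite (bigD1 (BMultinom lt1, BMultinom lt2)) /=; last by rewrite -mE.
rewrite eqxx mul1r big1 ?addr0 // => -[k1 k2] /= /andP[/eqP kE neq].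
case: eqP => [k1E|_]; last by rewrite mul0r.
case/eqP: neq; congr (_, _); apply: val_inj => //=.
by have := congr1 (fun u => u - U_(c))%MM kE; rewrite /= k1E addmC addmK => ->.
Qed.

Lemma mps_varB_neq0 c e : c != e -> X c - X e != 0.
Proof.
move=> ce; apply/eqP => /(congr1 (fun f : {series R[n]} => f U_(c)%MM)).
rewrite mpsBE /= eqxx eq_mnm1 (negPf ce) subr0.
by apply/eqP; rewrite oner_neq0.
Qed.

Definition free_of a f := forall m, (0 < m a)%N -> f m = 0.

Lemma free_of_varBM a c e f :
  a != c -> a != e -> free_of a f -> free_of a ((X c - X e) * f).
Proof.
move=> ac ae f_free m ma; rewrite mulrBl mpsBE !mps_varM_coef.
have shift0 i : a != i -> f (m - U_(i))%MM = 0.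
  by move=> ai; apply: f_free; rewrite mnmBE mnm1E eq_sym (negPf ai) subn0.
by rewrite !shift0 // !if_same subrr.
Qed.

(** The coefficient at m sums f over the part of the line m + Z (U_a - U_b)
    that starts at m and lets the exponent of X_b drop to 0.  On the monomials
    without X_a this is the substitution of X_b for X_a; elsewhere it gives the
    quotient by X_a - X_b. *)
Definition antidiagonal_sum a b f : {series R[n]} := MPSeries (fun m =>
  \sum_(s < (m b).+1) f (m + U_(a) *+ s - U_(b) *+ s)%MM).

Definition subst_var a b f : {series R[n]} := MPSeries (fun m =>
  if m a == 0 then antidiagonal_sum a b f m else 0).

Lemma subst_var_free a b f : free_of a (subst_var a b f).
Proof. by move=> m /=; rewrite lt0n => /negPf ->. Qed.

(** With h_m the sum at m + U_a, splitting off the first term of the sum gives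
    f + X_b h, and splitting the monomials according to whether X_a occurs
    gives subst_var a b f + X_a h.  Subtracting the two expressions shows that
    h is the quotient. *)
Lemma subst_var_modulo a b f : a != b ->
  divides (X a - X b) (f - subst_var a b f).
Proof.
move=> ab; pose h : {series R[n]} :=
  MPSeries (fun m => antidiagonal_sum a b f (m + U_(a))%MM).
have sumE : antidiagonal_sum a b f = f + X b * h.
  apply: mpsP => m; rewrite mpsDE mps_varM_coef /= big_ord_recl /=.
  congr (_ + _).
    by congr (f _); apply/mnmP => i; rewrite !(mnmBE, mnmDE, mulmnE) !muln0; lia.
  case: ltnP => [mb|]; last first.
    by rewrite leqn0 => /eqP ->; rewrite big_ord0.
  have -> : ((m - U_(b) + U_(a))%MM b).+1 = m b.
    by rewrite !(mnmBE, mnmDE, mnm1E) eqxx (negPf ab); lia.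
  apply: eq_bigr => s _; congr (f _); apply/mnmP => i.
  rewrite !(mnmBE, mnmDE, mulmnE, mnm1E) /bump /=.
  have := ltn_ord s.
  have [<-|_] := eqVneq a i; first by rewrite [b == a]eq_sym (negPf ab); lia.
  by have [<-|_] := eqVneq b i; lia.
have substE : antidiagonal_sum a b f = subst_var a b f + X a * h.
  apply: mpsP => m; rewrite mpsDE mps_varM_coef [(subst_var a b f) m]/= lt0n.
  case: eqVneq => [ma|ma] /=; rewrite ?addr0 // add0r.
  rewrite /= submK //; apply/mnm_lepP => i; rewrite mnm1E.
  by case: eqP => // <-; rewrite lt0n.
exists h; apply/eqP; rewrite mulrBl subr_eq addrAC eq_sym subr_eq.
by rewrite addrC -substE sumE.
Qed.

(** If f = (X_a - X_b) h has no X_a, comparing coefficients at m + U_a gives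
    h_m = h_(m + U_a - U_b), or h_m = 0 when m has no X_b.  Induction on the
    exponent of X_b makes h vanish. *)
Lemma divides_free a b f : a != b ->
  free_of a f -> divides (X a - X b) f -> f = 0.
Proof.
move=> ab f_free [h fE]; suff h0 : h = 0 by rewrite fE h0 mulr0.
suff h0 N : forall m, m b = N -> h m = 0 by apply: mpsP => m; apply: h0.
elim: N => [|N IH] m mb.
all: have := f_free (m + U_(a))%MM; rewrite fE mulrBl mpsBE !mps_varM_coef.
all: rewrite !mnmDE !mnm1E eqxx (negPf ab) addn0 addn1 addmK => /(_ isT).
  by rewrite mb /= subr0.
rewrite mb /= (IH (_ - _)%MM) ?subr0 // mnmBE mnmDE !mnm1E eqxx (negPf ab).
by rewrite mb; lia.
Qed.

(** It suffices to cancel on the normal form s of f: (X_c - X_e) s has no X_a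
    and is divisible by X_a - X_b, so it vanishes, and s = 0 because power
    series form a domain. *)
Lemma divides_varB_cancel a b c e f : a != b -> a != c -> a != e -> c != e ->
  divides (X a - X b) ((X c - X e) * f) -> divides (X a - X b) f.
Proof.
move=> ab ac ae ce dvd_cf; have dvd_fs := subst_var_modulo f ab.
suff /eqP : (X c - X e) * subst_var a b f = 0.
  rewrite mulf_eq0 (negPf (mps_varB_neq0 ce)) /= => /eqP s0.
  by move: dvd_fs; rewrite s0 subr0.
apply: divides_free (ab) _ _.
  by apply: free_of_varBM => //; apply: subst_var_free.
have -> : (X c - X e) * subst_var a b f =
    (X c - X e) * f - (X c - X e) * (f - subst_var a b f) by ring.
by apply: dividesB => //; apply: divides_mull.
Qed.

(** Exchanging X_a and X_b reverses the antidiagonals. *)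
Lemma subst_var_tperm a b f : a != b ->
  subst_var a b (mps_perm (tperm a b) f) = subst_var a b f.
Proof.
move=> ab; apply: mpsP => m /=; case: eqP => // ma.
rewrite [RHS](reindex_inj rev_ord_inj) /=; apply: eq_bigr => s _.
congr (f _); apply/mnmP => i; rewrite !(mnmE, mnmBE, mnmDE, mulmnE, mnm1E).
have := ltn_ord s.
case: tpermP => [->|->|/eqP ia /eqP ib].
- by rewrite eqxx [b == a]eq_sym (negPf ab) eqxx ma; lia.
- by rewrite eqxx [b == a]eq_sym (negPf ab) eqxx ma; lia.
- by rewrite ![_ == i]eq_sym (negPf ia) (negPf ib); lia.
Qed.

(** Both series have the same normal form modulo X_a - X_b. *)
Lemma divides_tperm a b f : a != b ->
  divides (X a - X b) (mps_perm (tperm a b) f - f).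
Proof.
move=> ab; set g := mps_perm _ f.
have -> : g - f = (g - subst_var a b g) - (f - subst_var a b f).
  by rewrite subst_var_tperm //; ring.
by apply: dividesB; apply: subst_var_modulo.
Qed.

End VariableDifference.

(** * Roots in the formal group algebra *)

Section Roots.
Variable n : nat.
Implicit Types (a b c e : 'I_n) (l : lattice n) (w : 'S_n) (f : FGAq n).

Lemma x_opp l : x_ l + x_ (- l) - beta n * x_ l * x_ (- l) = 0.
Proof. by rewrite -[LHS]/(fgl_add _ _ _) -x_D subrr x_0. Qed.

Lemma x_sub a b : x_ (y_ a) - x_ (y_ b) =
  x_ (y_ a - y_ b) * (1 - beta n * x_ (y_ b)).
Proof.
have /(congr1 (@x_ n)) : y_ a = (y_ a - y_ b) + y_ b by rewrite subrK.
rewrite x_D /fgl_add => {1}->; ring.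
Qed.

(** By the formal group law X_a - X_b = x_{y_a - y_b} (1 - beta X_b), and
    1 - beta X_b is invertible with inverse 1 - beta x_{- y_b}. *)
Lemma divides_x_root a b (f : FGA n) :
  divides (x_ (y_ a - y_ b)) f <-> divides (mps_var _ a - mps_var _ b) f.
Proof.
rewrite -!x_y; split; apply: divides_trans; last first.
  by rewrite x_sub; apply/divides_mulr/divides_self.
exists (1 - beta n * x_ (- y_ b)); rewrite x_sub.
have bb := x_opp (y_ b); set z := x_ (_ - _).
transitivity (z * (1 - beta n *
   (x_ (y_ b) + x_ (- y_ b) - beta n * x_ (y_ b) * x_ (- y_ b)))); last by ring.
by rewrite bb mulr0 subr0 mulr1.
Qed.

Lemma divides_xFGAq l f : divides (xFGAq l) f <-> forall m, divides (x_ l) (f m).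
Proof. exact: divides_const. Qed.

Definition betaq : FGAq n := mps_const 1 (beta n).

Lemma xFGAq_opp l :
  xFGAq l + xFGAq (- l) - betaq * xFGAq l * xFGAq (- l) = 0.
Proof. by rewrite /xFGAq /betaq -!rmorphM -rmorphD -rmorphB x_opp rmorph0. Qed.

Lemma divides_xFGAq_opp l : divides (xFGAq l) (xFGAq (- l)).
Proof.
exists (betaq * xFGAq (- l) - 1); apply/eqP; rewrite -subr_eq0; apply/eqP.
by rewrite -[RHS](xFGAq_opp l); ring.
Qed.

Lemma divides_root_sym a b f :
  divides (xFGAq (y_ a - y_ b)) f -> divides (xFGAq (y_ b - y_ a)) f.
Proof.
by apply: divides_trans; rewrite -[y_ a - _]opprB; apply: divides_xFGAq_opp.
Qed.

Lemma xFGAq_root_neq0 a b : a != b -> xFGAq (y_ a - y_ b) != 0.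
Proof.
move=> ab; apply/eqP => /(congr1 (fun f : FGAq n => f 0%MM)).
rewrite /= eqxx mulr1n => x0.
have := @mps_varB_neq0 {poly int} n _ _ ab.
by rewrite -!x_y x_sub x0 mul0r eqxx.
Qed.

Lemma divides_fgaq_tperm a b f : a != b ->
  divides (xFGAq (y_ a - y_ b)) (fgaq_act (tperm a b) f - f).
Proof.
move=> ab; apply/divides_xFGAq => m; apply/divides_x_root.
exact: divides_tperm.
Qed.

(** Two distinct transpositions have distinct supports, so one of a, b lies
    outside {c, e}; divisibility is symmetric in a and b, hence this may be
    assumed of a, and the variable X_a is absent from X_c - X_e. *)
Lemma divides_root_cancel a b c e f : a != b -> c != e ->
  tperm a b != tperm c e ->
  divides (xFGAq (y_ a - y_ b)) (xFGAq (y_ c - y_ e) * f) ->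
  divides (xFGAq (y_ a - y_ b)) f.
Proof.
move=> + ce; wlog [ac ae] : a b / a != c /\ a != e => [main|] ab neq dvd_cf.
  have [/andP[ac ae]|] := boolP ((a != c) && (a != e)); first exact: main dvd_cf.
  rewrite negb_and !negbK => a_ce; apply: divides_root_sym.
  apply: main (divides_root_sym dvd_cf); [|by rewrite eq_sym|by rewrite tpermC].
  split; apply: contraNneq neq => bE; move: a_ce ab; rewrite -bE.
    by move=> /orP[] /eqP ->; rewrite ?eqxx // tpermC eqxx.
  by move=> /orP[] /eqP ->; rewrite ?eqxx.
apply/divides_xFGAq => m; apply/divides_x_root.
apply: (divides_varB_cancel ab ac ae ce).
have /divides_xFGAq/(_ m)/divides_x_root := dvd_cf.
rewrite mps_constM_coef -!x_y (x_sub c e) => /(divides_mulr (1 - beta n * x_ (y_ e))).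
by rewrite [z in divides _ z -> _]mulrAC.
Qed.

Lemma lat_act_y w a : lat_act w (y_ a) = y_ (w a).
Proof.
apply/ffunP => i; rewrite !ffunE; congr (nat_of_bool _)%:Z.
by rewrite -(inj_eq (@perm_inj _ w)) permKV.
Qed.

Lemma fgaq_act_root w a b :
  fgaq_act w (xFGAq (y_ a - y_ b)) = xFGAq (y_ (w a) - y_ (w b)).
Proof.
rewrite fgaq_act_x -!lat_act_y; congr xFGAq.
by apply/ffunP => i; rewrite !ffunE.
Qed.

Lemma divides_fgaq_act w a b f :
  divides (xFGAq (y_ a - y_ b)) f ->
  divides (xFGAq (y_ (w a) - y_ (w b))) (fgaq_act w f).
Proof. by rewrite -fgaq_act_root; apply: divides_morph. Qed.

End Roots.

(** * GKM families and Demazure-Lusztig operators *)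

Lemma frac_act_tofrac n (w : 'S_n) (f : FGAq n) :
  frac_act w (tofrac f) = tofrac (fgaq_act w f).
Proof.
rewrite -[tofrac f]divr1 -tofrac1 frac_act_div ?oner_neq0 //.
by rewrite rmorph1 tofrac1 divr1.
Qed.

Lemma fgaq_actB n (w : 'S_n) (f g : FGAq n) :
  fgaq_act w (f - g) = fgaq_act w f - fgaq_act w g.
Proof. exact: rmorphB. Qed.

Lemma fgaq_actM n (w : 'S_n) (f g : FGAq n) :
  fgaq_act w (f * g) = fgaq_act w f * fgaq_act w g.
Proof. exact: rmorphM. Qed.

(** Applied with X = x_alpha and Y = x_{-alpha}: the inverse of Y is B - 1/X, so
    the poles of the two fractions cancel. *)
Lemma div_opposite_sum (K : fieldType) (X Y B F C : K) :
  Y != 0 -> X != 0 -> X + Y - B * X * Y = 0 ->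
  F / Y + (X * C + F) / X = C + B * F.
Proof.
move=> Y0 X0 opE; apply/eqP; rewrite -subr_eq0; apply/eqP.
transitivity (F * (X + Y - B * X * Y) / (X * Y)); first by field; rewrite Y0 X0.
by rewrite opE mulr0 mul0r.
Qed.

Section GKM.
Variables (n d : nat) (I : flag_type n d).
Implicit Types (mu : Gamma I) (f g : Gamma I -> FGAq n) (a b : 'I_n).

Lemma Gamma_actM (v w : 'S_n) mu :
  Gamma_act (v * w) mu = Gamma_act w (Gamma_act v mu).
Proof.
by apply/val_inj/eq_from_tnth => i; rewrite !tnth_mktuple invMg permM.
Qed.

Lemma Gamma_act1 mu : Gamma_act 1 mu = mu.
Proof. by apply/val_inj/eq_from_tnth => i; rewrite !tnth_mktuple invg1 perm1. Qed.

(** All transpositions are included, also those inside a block, because the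
    twist by r_i permutes the conditions for different transpositions. *)
Definition GKM f := forall a b mu, a != b ->
  divides (xFGAq (y_ a - y_ b)) (f mu - f (Gamma_act (tperm a b) mu)).

(** The condition for (a b) on the twisted family is the image under w of the
    condition for the conjugate transposition on f. *)
Lemma GKM_act w f : GKM f ->
  GKM (fun mu => fgaq_act w (f (Gamma_act w^-1 mu))).
Proof.
move=> fP a b mu ab; rewrite -rmorphB.
rewrite -{1}[a](permKV w) -{1}[b](permKV w); apply: divides_fgaq_act.
have -> : Gamma_act w^-1 (Gamma_act (tperm a b) mu) =
    Gamma_act (tperm (w^-1 a) (w^-1 b))%g (Gamma_act w^-1 mu).
  by rewrite -!Gamma_actM -tpermJ conjgE invgK mulKg.
by apply: fP; rewrite (inj_eq (@perm_inj _ _)).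
Qed.

Lemma GKM_lin (u v : FGAq n) f g : GKM f -> GKM g ->
  GKM (fun mu => u * f mu + v * g mu).
Proof.
move=> fP gP a b mu ab; set nu := Gamma_act _ mu.
have -> : u * f mu + v * g mu - (u * f nu + v * g nu) =
  u * (f mu - f nu) + v * (g mu - g nu) by ring.
by apply: dividesD; apply: divides_mull; [apply: fP | apply: gP].
Qed.

Section Reflection.
Variable i : 'I_n.-1.
Local Notation r := (srefl i).
Local Notation x := (xFGAq (alpha i)).

Lemma lo_neq_hi : lo i != hi i.
Proof. by rewrite -val_eqE /= neq_ltn ltnSn. Qed.

Lemma srefl_actK mu : Gamma_act r (Gamma_act r mu) = mu.
Proof. by rewrite -Gamma_actM tperm2 Gamma_act1. Qed.

Lemma fgaq_act_sreflK (f : FGAq n) : fgaq_act r (fgaq_act r f) = f.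
Proof.
apply: mpsP => m; apply: mpsP => k /=; congr (f m _).
by apply/mnmP => j; rewrite !mnmE tpermK.
Qed.

Lemma GKM_srefl f : GKM f -> GKM (fun mu => fgaq_act r (f (Gamma_act r mu))).
Proof. by move/(GKM_act r); rewrite tpermV. Qed.

(** Modulo x, r acts trivially and f_{r mu} = f_mu, so the numerator
    vanishes. *)
Lemma srefl_quotient f : GKM f -> exists c : Gamma I -> FGAq n,
  forall mu, fgaq_act r (f (Gamma_act r mu)) - f mu = x * c mu.
Proof.
move=> fP; suff /choice[c cE] : forall mu,
    divides x (fgaq_act r (f (Gamma_act r mu)) - f mu) by exists c.
move=> mu.
have -> : fgaq_act r (f (Gamma_act r mu)) - f mu =
  (fgaq_act r (f (Gamma_act r mu)) - f (Gamma_act r mu))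
    - (f mu - f (Gamma_act r mu)) by ring.
apply: dividesB; last exact: fP lo_neq_hi.
exact: divides_fgaq_tperm lo_neq_hi.
Qed.

(** For a transposition other than r the numerators form a GKM family and x is
    cancelled.  For r itself, applying r to the equation that defines c_mu
    exchanges the two terms of the numerator up to sign, which relates r(c_mu)
    to c_{r mu}. *)
Lemma GKM_quotient f c : GKM f ->
  (forall mu, fgaq_act r (f (Gamma_act r mu)) - f mu = x * c mu) -> GKM c.
Proof.
move=> fP cE a b mu ab; have x_neq0 : x != 0 := xFGAq_root_neq0 lo_neq_hi.
have [abE|ab_neq] := eqVneq (tperm a b) r; last first.
  apply: (divides_root_cancel ab lo_neq_hi ab_neq).
  rewrite -/(alpha i) mulrBr -!cE.
  have := dividesB (GKM_srefl fP mu ab) (fP a b mu ab).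
  by set t := tperm a b; congr divides; ring.
have root_div (z : FGAq n) : divides x z -> divides (xFGAq (y_ a - y_ b)) z.
  have rlo : r (lo i) = hi i by rewrite tpermL.
  have : tperm a b (lo i) = hi i by rewrite abE.
  rewrite /alpha; case: tpermP => [-> -> //|-> -> |_ _ E].
    exact: divides_root_sym.
  by have := lo_neq_hi; rewrite E eqxx.
rewrite abE; apply: root_div.
(* The image under r of x c_mu is x_{-alpha} r(c_mu), and it equals
   - x c_{r mu}; multiplying by 1 - beta x turns x_{-alpha} into - x. *)
have xc : x * fgaq_act r (c mu) = x * ((1 - betaq n * x) * c (Gamma_act r mu)).
  have /(congr1 (fgaq_act r)) := cE mu.
  rewrite fgaq_actB fgaq_act_sreflK fgaq_actM {1}/alpha fgaq_act_root.
  rewrite tpermL tpermR -[y_ (hi i) - _]opprB -/(alpha i) => cEr.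
  have := cE (Gamma_act r mu); rewrite srefl_actK => cE'.
  have x_opp := xFGAq_opp (alpha i).
  transitivity ((x + xFGAq (- alpha i) - betaq n * x * xFGAq (- alpha i))
     * fgaq_act r (c mu)
     - (1 - betaq n * x) * (xFGAq (- alpha i) * fgaq_act r (c mu))); first by ring.
  rewrite x_opp -cEr mul0r sub0r mulrCA -cE'; ring.
have {}xc := mulfI x_neq0 xc.
have -> : c mu - c (Gamma_act r mu) =
  - (fgaq_act r (c mu) - c mu) - x * (betaq n * c (Gamma_act r mu)).
  rewrite xc; ring.
apply: dividesB; last exact/divides_mulr/divides_self.
exact/dividesN/divides_fgaq_tperm/lo_neq_hi.
Qed.

Lemma DL_GKM f : GKM f ->
  exists2 g, GKM g & DL i (fun mu => tofrac (f mu)) = fun mu => tofrac (g mu).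
Proof.
move=> fP; have [c cE] := srefl_quotient fP; have cP := GKM_quotient fP cE.
(* The factor 1 gives c + betaq * f the shape expected by GKM_lin. *)
exists (fun mu => (1 - xq n ^+ 2) * (1 * c mu + betaq n * f mu)
   + xq n ^+ 2 * fgaq_act r (f (Gamma_act r mu))).
  by apply: GKM_lin; [apply: GKM_lin | apply: GKM_srefl].
apply: funext => mu; rewrite /DL !frac_act_tofrac.
rewrite [in RHS]tofracD ![in RHS]tofracM tofracB tofracXn tofrac1 -/(xqF n).
congr (_ * _ + _); rewrite tofracD !tofracM tofrac1 mul1r.
have /(congr1 (@tofrac _)) := cE mu; rewrite tofracB tofracM.
have /(congr1 (@tofrac _)) := xFGAq_opp (alpha i).
rewrite tofracB tofracD !tofracM tofrac0.
have : tofrac x != 0 by rewrite tofrac_eq0 xFGAq_root_neq0 ?lo_neq_hi.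
have : tofrac (xFGAq (- alpha i)) != 0.
  by rewrite tofrac_eq0 opprB xFGAq_root_neq0 // eq_sym lo_neq_hi.
rewrite /xF; move: (tofrac x) (tofrac (xFGAq _)) (tofrac (betaq n)) => X Y B.
move: (tofrac (f mu)) (tofrac (fgaq_act _ _)) (tofrac (c mu)) => F F' C.
move=> Y0 X0 opE /eqP; rewrite subr_eq => /eqP ->.
exact: div_opposite_sum.
Qed.

End Reflection.

End GKM.

(** * The starting family *)

Section StartingClass.
Variables (n d : nat) (I : flag_type n d).
Implicit Types (a b : 'I_n) (j : 'I_d.+1) (mu : Gamma I).

Local Notation block_start j := (I (widen_ord (leqnSn _) j)).
Local Notation block_end j := (I (lift ord0 j)).
Local Notation letters j := (nseq (part I j) (rev_ord j)).

Lemma size_w0_prefix k : (k <= d.+1)%N ->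
  size (flatten [seq letters j | j <- take k (enum 'I_d.+1)]) = I (inord k).
Proof.
elim: k => [_|k IH lt_k]; rewrite ?take0 /=.
  by rewrite (_ : inord 0 = ord0) ?step_first //; apply: val_inj; rewrite /= inordK.
rewrite (take_nth ord0) ?size_enum_ord // map_rcons flatten_rcons size_cat.
rewrite IH; last exact: ltnW.
set j := nth _ _ _; have jE : j = k :> nat by rewrite nth_enum_ord.
rewrite size_nseq /part.
have -> : inord k = widen_ord (leqnSn _) j.
  by apply: val_inj; rewrite /= inordK ?jE // ltnW.
have -> : inord k.+1 = lift ord0 j :> 'I_d.+2.
  by apply: ord_inj; rewrite lift0 inordK ?jE.
by rewrite subnKC // ltnW // step_lt.
Qed.

Lemma tnth_w0 a j : (block_start j <= a < block_end j)%N ->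
  tnth (val (w0 I)) a = rev_ord j.
Proof.
move=> /andP[le_a lt_a]; rewrite (tnth_nth (rev_ord j)) SubK /= /w0_seq.
rewrite -(cat_take_drop j (enum 'I_d.+1)) map_cat flatten_cat nth_cat.
have lt_j := ltn_ord j.
rewrite size_w0_prefix; last exact: ltnW.
have -> : inord j = widen_ord (leqnSn _) j.
  by apply: val_inj; rewrite /= inordK // ltnW.
rewrite ltnNge le_a /= (drop_nth ord0) ?size_enum_ord //.
have -> : nth ord0 (enum 'I_d.+1) j = j by apply: val_inj; rewrite /= nth_enum_ord.
by rewrite /= nth_cat size_nseq ltn_sub2r ?nth_nseq ?if_same //; apply: leq_ltn_trans lt_a.
Qed.

Lemma block_ex a : exists j, (block_start j <= a < block_end j)%N.
Proof.
have le0 : (I ord0 <= a)%N by rewrite step_first.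
case: (@arg_maxnP _ ord0 (fun m : 'I_d.+2 => I m <= a)%N (fun m => m) le0) => m le_m m_max.
have lt_m : (m < d.+1)%N.
  rewrite ltn_neqAle -ltnS ltn_ord andbT; apply/eqP => mE.
  have m_last : m = ord_max by apply: val_inj.
  by move: le_m; rewrite m_last step_last leqNgt ltn_ord.
exists (Ordinal lt_m); apply/andP; split.
  by rewrite (_ : widen_ord _ _ = m) //; apply: val_inj.
rewrite ltnNge; apply/negP => /m_max; rewrite lift0 /=.
by rewrite ltnn.
Qed.

(** If the transposition moves w0, the letters of w0 at a and b differ, so the
    end of the block of a separates a from b. *)
Lemma w0_moved_SigmaPos a b : (a < b)%N ->
  Gamma_act (tperm a b) (w0 I) != w0 I -> y_ a - y_ b \in SigmaPos I.
Proof.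
move=> lt_ab moved; apply/mapP; exists (a, b) => //.
rewrite mem_filter mem_enum andbT /in_SigmaPos lt_ab /=.
have [j /andP[le_a lt_a]] := block_ex a.
have [le_b|lt_b] := leqP (block_end j) b.
  by apply/existsP; exists (lift ord0 j); rewrite lt_a le_b.
case/eqP: moved; apply/val_inj/eq_from_tnth => i.
rewrite tnth_mktuple tpermV.
have same : tnth (val (w0 I)) a = tnth (val (w0 I)) b.
  by rewrite !(@tnth_w0 _ j) ?le_a ?lt_a ?lt_b ?(leq_trans le_a (ltnW lt_ab)).
by case: tpermP => [->|->|].
Qed.

Definition class_w0 : Gamma I -> FGAq n :=
  fun mu => if mu == w0 I then \prod_(l <- SigmaPos I) xFGAq (- l) else 0.

Lemma St_w0_integral : St_w0 (I := I) = fun mu => tofrac (class_w0 mu).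
Proof.
apply: funext => mu; rewrite /St_w0 /class_w0; case: eqP => _.
  by rewrite (big_morph _ (@tofracM _) (@tofrac1 _)).
by rewrite tofrac0.
Qed.

(** When the transposition fixes w0, a and b may lie in one block and
    divisibility can fail; the difference in the GKM condition is then 0. *)
Lemma divides_class_w0 a b mu : a != b ->
  Gamma_act (tperm a b) (w0 I) != w0 I ->
  divides (xFGAq (y_ a - y_ b)) (class_w0 mu).
Proof.
wlog lt_ab : a b / (a < b)%N => [main ab moved|_ moved].
  have [lt_ab|lt_ba|/val_inj abE] := ltngtP a b; first exact: main.
    by apply: divides_root_sym; apply: main => //; [rewrite eq_sym | rewrite tpermC].
  by rewrite abE eqxx in ab.
rewrite /class_w0; case: eqP => _; last exact: divides0.
rewrite (big_rem _ (w0_moved_SigmaPos lt_ab moved)) /=.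
exact/divides_mulr/divides_xFGAq_opp.
Qed.

Lemma GKM_class_w0 : GKM class_w0.
Proof.
move=> a b mu ab.
have [fixed|moved] := eqVneq (Gamma_act (tperm a b) (w0 I)) (w0 I); last first.
  by apply: dividesB; apply: divides_class_w0.
rewrite /class_w0 (_ : (Gamma_act _ mu == _) = (mu == w0 I)).
  by rewrite subrr; apply: divides0.
apply/eqP/eqP => [moved|->] //.
by rewrite -[mu]Gamma_act1 -(tperm2 a b) Gamma_actM moved.
Qed.

Lemma DL_word_GKM s : exists2 g : Gamma I -> FGAq n,
  GKM g & DL_word s (St_w0 (I := I)) = fun mu => tofrac (g mu).
Proof.
elim: s => [|i s [g gP /= ->]]; last exact: DL_GKM.
by exists class_w0; [apply: GKM_class_w0 | apply: St_w0_integral].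
Qed.

End StartingClass.

Theorem proposition7p32 (n d : nat) (hd : (0 < d)%N) (I : flag_type n d)
    (j k : 'I_n) (hjk : (j < k)%N) (hS : y_ j - y_ k \in Sigma I)
    (lam : Gamma I) (St : Gamma I -> FracFGAq n) (hSt : is_St lam St) :
  exists2 g : Gamma I -> FGAq n,
    (forall mu : Gamma I, St mu = tofrac (g mu)) &
    (forall mu : Gamma I, exists h : FGAq n,
       g mu - g (Gamma_act (tperm j k) mu) = xFGAq (y_ j - y_ k) * h).
Proof.
have [s _ ->] := hSt; have [g gP ->] := DL_word_GKM I s.
exists g => // mu; apply: gP.
by rewrite -val_eqE neq_ltn hjk.
Qed.
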